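(* Let $\mathscr{H}$ be a complex Hilbert space, $d\ge1$, and let $\mathbf{A}=(A_1,\ldots,A_d)\in\mathbb{B}^d(\mathscr{H})$. Then $$w_e(\mathbf{A})\le\sqrt{\frac12\left\|\sum_{k=1}^d\left(|A_k^*|^{4(1-t)}+|A_k|^{4t}\right)\right\|}$$ for all $t$, $0\le t\le1$. In particular, $$w_e(\mathbf{A})\le\sqrt{\frac12\left\|\sum_{k=1}^d\left(|A_k^*|^{2}+|A_k|^{2}\right)\right\|}.$$
   Context: $\mathbb{B}(\mathscr{H})$ is the algebra of bounded linear operators on the complex Hilbert space $\mathscr{H}$, and $\mathbb{B}^d(\mathscr{H})$ is the set of $d$-tuples of such operators. For $T\in\mathbb{B}(\mathscr{H})$, $|T|=(T^*T)^{1/2}$, $|T|^0=I$ (identity operator), and $\|T\|$ is the operator norm. The Euclidean operator radius of $\mathbf{A}=(A_1,\ldots,A_d)$ is $w_e(\mathbf{A})=\sup\{(\sum_{k=1}^d|\langle A_kx,x\rangle|^2)^{1/2}:\|x\|=1\}$. *)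

(* Defs.v *)
From HB Require Import structures.
From mathcomp Require Import all_boot all_order all_algebra.
From mathcomp Require Import complex.
From mathcomp Require Import all_classical all_reals all_analysis.

Set Implicit Arguments.
Unset Strict Implicit.
Unset Printing Implicit Defensive.

Import Order.TTheory GRing.Theory Num.Theory.
Import numFieldNormedType.Exports.

Local Open Scope classical_set_scope.
Local Open Scope ring_scope.
Local Open Scope complex_scope.

(* A form in [{dot H for conj}] is linear in its first argument and
   conjugate-linear in its second one. *)
HB.mixin Record CompleteNormedModule_isHilbert (R : realType) H
    of CompleteNormedModule R[i] H := {
  inner : {dot H for Num.conj} ;
  inner_normE : forall x : H, inner x x = `|x| ^+ 2
}.

#[short(type="hilbertType")]
HB.structure Definition Hilbert (R : realType) :=
  {H of CompleteNormedModule_isHilbert R H & CompleteNormedModule R[i] H}.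

Local Notation "''[' x , y ]" := (inner x y) : ring_scope.

(* In the library the norm of a space over [R[i]] takes its values in [R[i]];
   [rnorm] is the same number as an element of [R]. *)
Definition rnorm (R : realType) (V : normedZmodType R[i]) (x : V) : R :=
  complex.Re `|x|.

Lemma rnorm_ge0 (R : realType) (V : normedZmodType R[i]) (x : V) :
  0 <= rnorm x.
Proof. by have := normr_ge0 x; rewrite lecE => /andP[]. Qed.

Lemma rnormE (R : realType) (V : normedZmodType R[i]) (x : V) :
  (rnorm x)%:C = `|x|.
Proof. by rewrite /rnorm RRe_real // normr_real. Qed.

Lemma rnormD (R : realType) (V : normedZmodType R[i]) (x y : V) :
  rnorm (x + y) <= rnorm x + rnorm y.
Proof. by rewrite -lecR rmorphD /= !rnormE ler_normD. Qed.

Lemma rnormZ (R : realType) (V : normedModType R[i]) (a : R[i]) (x : V) :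
  rnorm (a *: x) = rnorm a * rnorm x.
Proof. by apply: complexI; rewrite rmorphM /= !rnormE normrZ. Qed.

Section BoundedOperators.
Variables (R : realType) (H : hilbertType R).

Definition bounded_op : {pred H -> H} := fun f =>
  `[< linear f /\ exists M : R, forall x, rnorm (f x) <= M * rnorm x >].

Record bop := Bop { bop_val : H -> H ; bop_valP : bop_val \in bounded_op }.

HB.instance Definition _ := [isSub for bop_val].
HB.instance Definition _ := [Choice of bop by <:].

Lemma bounded_opP (f : H -> H) : reflect
  (linear f /\ exists2 M : R, 0 <= M & forall x, rnorm (f x) <= M * rnorm x)
  (f \in bounded_op).
Proof.
apply: (iffP idP) => [/asboolP[lf [M fM]]|[lf [M _ fM]]]; last first.
  by apply/asboolP; split=> //; exists M.
split=> //; exists `|M|; first exact: normr_ge0.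
move=> x; apply: (le_trans (fM x)); apply: ler_wpM2r; last exact: ler_norm.
exact: rnorm_ge0.
Qed.

Lemma bounded_op_submod : submod_closed bounded_op.
Proof.
split.
  apply/bounded_opP; split; first by move=> a x y; rewrite /= scaler0 addr0.
  by exists 0 => // x; rewrite mul0r /rnorm normr0.
move=> a f g /bounded_opP[lf [M M0 fM]] /bounded_opP[lg [N N0 gN]].
apply/bounded_opP; split.
  move=> b x y; rewrite !fctE lf lg !scalerDr !scalerA [a * b]mulrC.
  by rewrite addrACA.
have a0 := rnorm_ge0 a.
exists (rnorm a * M + N); first by rewrite addr_ge0 // mulr_ge0.
move=> x; rewrite !fctE; apply: (le_trans (rnormD _ _)).
by rewrite mulrDl lerD // rnormZ -mulrA ler_wpM2l.
Qed.

HB.instance Definition _ :=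
  GRing.isSubmodClosed.Build R[i] (H -> H) bounded_op bounded_op_submod.
HB.instance Definition _ := [SubChoice_isSubLmodule of bop by <:].

Lemma bounded_op_id : (id : H -> H) \in bounded_op.
Proof. by apply/bounded_opP; split=> //; exists 1 => // x; rewrite mul1r. Qed.

Lemma bounded_op_comp (S T : bop) : bop_val S \o bop_val T \in bounded_op.
Proof.
have /bounded_opP[lS [M M0 SM]] := bop_valP S.
have /bounded_opP[lT [N N0 TN]] := bop_valP T.
apply/bounded_opP; split; first by move=> a x y; rewrite /= lT lS.
exists (M * N); first exact: mulr_ge0.
by move=> x; apply: (le_trans (SM _)); rewrite -mulrA ler_wpM2l.
Qed.

Definition bop1 : bop := Bop bounded_op_id.
Definition bop_mul (S T : bop) : bop := Bop (bounded_op_comp S T).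

Fact bop_mulA : associative bop_mul.
Proof. by move=> S T U; apply: val_inj. Qed.

Fact bop_mul1l : left_id bop1 bop_mul.
Proof. by move=> T; apply: val_inj. Qed.

Fact bop_mul1r : right_id bop1 bop_mul.
Proof. by move=> T; apply: val_inj. Qed.

Fact bop_mulDl : left_distributive bop_mul +%R.
Proof. by move=> S T U; apply: val_inj. Qed.

Fact bop_mulDr : right_distributive bop_mul +%R.
Proof.
move=> S T U; apply: val_inj; apply/funext => x /=.
have /bounded_opP[lS _] := bop_valP S.
by have := lS 1 (bop_val T x) (bop_val U x); rewrite !scale1r.
Qed.

HB.instance Definition _ := GRing.Zmodule_isPzRing.Build bop
  bop_mulA bop_mul1l bop_mul1r bop_mulDl bop_mulDr.

End BoundedOperators.

Notation "''B' ( H )" := (bop H) (at level 8, format "''B' ( H )") : type_scope.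
Coercion bop_val : bop >-> Funclass.

Section OperatorNotions.
Variables (R : realType) (H : hilbertType R).
Implicit Types (S T P : 'B(H)) (p : {poly R}) (r : R).

(* The closed unit ball, rather than the unit sphere, so that the set is
   nonempty also when [H] is the zero space. *)
Definition opnorm T : R := sup [set rnorm (T x) | x in [set x | rnorm x <= 1]].

(* The bounded operator adjoint to [T]: it exists by the Riesz representation
   theorem and is unique, so the default value 0 is never used. *)
Definition adjoint T : 'B(H) :=
  xget 0 [set S : 'B(H) | forall x y, '[T x, y] = '[x, S y]].

Definition poly_op p T : 'B(H) := \sum_(i < size p) (p`_i)%:C *: T ^+ i.

(* Continuous functional calculus of a positive operator [S], whose spectrum
   lies in [0, ||S||]: [P] is [f(S)] when it is the norm limit of [p_n(S)] for
   polynomials [p_n] converging to [f] uniformly on [0, ||S||]. *)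
Definition is_calculus (f : R -> R) S P : Prop :=
  exists p : nat -> {poly R},
    {uniform `[0, opnorm S]%classic, (fun n x => (p n).[x]) @ \oo --> f} /\
    (fun n => opnorm (poly_op (p n) S - P)) @ \oo --> (0 : R).

(* [S^r] for positive [S] and [r >= 0]; the limit exists and is unique because
   polynomials are dense in C([0, ||S||]) and [p |-> p(S)] is contractive.
   Since [powR 0 0 = 1], [S^0] is the identity. *)
Definition powop S r : 'B(H) := xget 0 [set P | is_calculus (fun x => x `^ r) S P].

Definition absop T : 'B(H) := powop (adjoint T * T) 2^-1.

Definition euclidean_radius (d : nat) (A : 'I_d -> 'B(H)) : R :=
  sup [set Num.sqrt (\sum_(k < d) rnorm '[A k x, x] ^+ 2)
      | x in [set x | rnorm x = 1]].

End OperatorNotions.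

(* Main.v *)
Require Import Defs.
From HB Require Import structures.
From mathcomp Require Import all_boot all_order all_algebra.
From mathcomp Require Import complex ring lra.
From mathcomp Require Import all_classical all_reals all_analysis.

Set Implicit Arguments.
Unset Strict Implicit.
Unset Printing Implicit Defensive.

Import Order.TTheory GRing.Theory Num.Theory.
Import numFieldNormedType.Exports.

Local Open Scope classical_set_scope.
Local Open Scope ring_scope.
Local Open Scope complex_scope.

Local Notation "''[' x , y ]" := (inner x y) : ring_scope.

(** The scalar inequality behind the theorem is Kato's mixed Schwarz inequality
    [|<Ax, y>| <= || |A|^t x || || |A*|^(1-t) y ||] ([mixed_schwarz]).  Take
    [y = x] with [||x|| = 1].  The arithmetic-geometric mean inequality bounds
    [|<Ax, x>|^2] by half the sum of the fourth powers of the two norms, and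
    [||P^r x||^4 = <P^(2r) x, x>^2 <= ||P^(2r) x||^2 = <P^(4r) x, x>] turns
    these into [<|A|^(4t) x, x>] and [<|A*|^(4(1-t)) x, x>]
    ([sqr_inner_le]).  Summing over [k] and bounding the quadratic form of the
    sum by its operator norm gives the first claim; the second one is the case
    [t = 1/2].

    Kato's inequality is usually read off the polar decomposition.  Here only
    the relation [A |A| = |A*| A] ([absop_intertwine]) is used, which lets any
    polynomial pass through [A]: [A p(|A|) = p(|A*|) A].  For [t < 1] there are
    polynomials [k_n] with [u k_n(u)] converging to [u^(1-t)] uniformly, so that
    [A k_n(|A|) |A|^t] converges to [A] while the norm of
    [A* k_n(|A*|) y] converges to that of [|A*|^(1-t) y]; Cauchy-Schwarz does
    the rest ([rinner_mixed_schwarz]).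

    All this presupposes that adjoints and real powers exist and that powers
    are determined by any uniform polynomial approximation.  Adjoints come from
    the Riesz representation theorem ([riesz]).  For powers one needs
    - that [||p(S)||] is at most the supremum of [|p|] on [[0, M]] when
      [0 <= S <= M] ([poly_op_contraction]), which follows from an algebraic
      certificate of positivity on an interval ([nonneg_poly_cone]) and thus
      avoids spectral theory;
    - that [u^r] is a uniform limit of polynomials on [[0, M]]
      ([powR_poly_ulim]), by Bernstein polynomials;
    - that the bounded operators are complete for the operator norm
      ([oplim_complete]).
    The resulting calculus is multiplicative and unique, whence
    [S^(r+s) = S^r S^s], [S^1 = S] and [S^0 = 1]. *)

(** * The real inner product *)

Section RealInnerProduct.
Variables (R : realType) (H : hilbertType R).
Implicit Types (x y z : H) (a : R).

(** The real part of the inner product makes the space a real inner product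
    space with the same norm.  Working with it keeps every inequality in [R],
    where the order is total; [inner_eq] and [rnorm_inner_le] lead back to the
    complex inner product. *)
Definition rinner x y : R := complex.Re '[x, y].

Lemma innerC x y : '[y, x] = Num.conj '[x, y].
Proof. by rewrite (hermC (inner (s:=H))) expr0 mul1r. Qed.

Lemma rinnerC x y : rinner x y = rinner y x.
Proof. by rewrite /rinner (innerC y x); case: '[y, x] => u v. Qed.

Lemma rinnerDl x y z : rinner (x + y) z = rinner x z + rinner y z.
Proof. by rewrite /rinner linearDl raddfD. Qed.

Lemma rinnerDr x y z : rinner x (y + z) = rinner x y + rinner x z.
Proof. by rewrite !(rinnerC x) rinnerDl. Qed.

Lemma rinnerNl x y : rinner (- x) y = - rinner x y.
Proof. by rewrite /rinner linearNl raddfN. Qed.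

Lemma rinnerNr x y : rinner x (- y) = - rinner x y.
Proof. by rewrite !(rinnerC x) rinnerNl. Qed.

Lemma rinnerZl a x y : rinner (a%:C *: x) y = a * rinner x y.
Proof.
rewrite /rinner linearZl_LR /=; case: '[x, y] => u v /=.
by rewrite mul0r subr0.
Qed.

Lemma rinnerZr a x y : rinner x (a%:C *: y) = a * rinner x y.
Proof. by rewrite !(rinnerC x) rinnerZl. Qed.

Lemma rinner_rnorm x : rinner x x = rnorm x ^+ 2.
Proof.
by rewrite /rinner inner_normE -rnormE -rmorphXn.
Qed.

Lemma rinner_ext y z : (forall u, rinner u y = rinner u z) -> y = z.
Proof.
move=> h; apply/eqP; rewrite -subr_eq0 -normr_eq0 -rnormE.
have : rinner (y - z) (y - z) = 0 by rewrite rinnerDr rinnerNr h subrr.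
by rewrite rinner_rnorm => /eqP; rewrite expf_eq0 /= => /eqP ->.
Qed.

Lemma rnorm_eq0 x : rnorm x = 0 -> x = 0.
Proof. by move=> h; apply/eqP; rewrite -normr_eq0 -rnormE h. Qed.

Lemma rnorm0 : rnorm (0 : H) = 0.
Proof. by rewrite /rnorm normr0. Qed.

Lemma rnormN x : rnorm (- x) = rnorm x.
Proof. by rewrite /rnorm normrN. Qed.

Lemma rnormB_sym x y : rnorm (x - y) = rnorm (y - x).
Proof. by rewrite -opprB rnormN. Qed.

Lemma rnorm_triangle y x z : rnorm (x - z) <= rnorm (x - y) + rnorm (y - z).
Proof. by apply: le_trans (rnormD _ _); rewrite subrKA. Qed.

Lemma rnorm_realC a : rnorm a%:C = `|a|.
Proof. by apply: complexI; rewrite rnormE normc_def /= expr0n /= addr0 sqrtr_sqr. Qed.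

Lemma rinner_cauchy_schwarz x y : `|rinner x y| <= rnorm x * rnorm y.
Proof.
have [y0|y0] := eqVneq (rnorm y) 0.
  rewrite (rnorm_eq0 y0) /rinner linear0r normr0 mulr_ge0 //; exact: rnorm_ge0.
have yp : 0 < rnorm y ^+ 2 by rewrite exprn_even_gt0.
rewrite -[leRHS]ger0_norm; last by rewrite mulr_ge0 // rnorm_ge0.
rewrite -ler_sqr ?nnegrE // !real_normK ?num_real // exprMn.
(* [|y|^2 (|x|^2 |y|^2 - <x,y>^2)] is the squared norm of
   [|y|^2 x - <x,y> y]. *)
rewrite -subr_ge0 -(pmulr_rge0 _ yp).
have := sqr_ge0 (rnorm ((rnorm y ^+ 2)%:C *: x - (rinner x y)%:C *: y)).
rewrite -[X in 0 <= X -> _]rinner_rnorm.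
rewrite !(rinnerDl, rinnerDr, rinnerNl, rinnerNr, rinnerZl, rinnerZr).
rewrite (rinnerC y x) !rinner_rnorm.
congr (0 <= _); ring.
Qed.

(** Taking for [c] the conjugate of [<x, y>] turns a bound on real parts, valid
    for all complex multiples of [x], into a bound on the modulus. *)
Lemma rnorm_inner_le x y K : (forall c : R[i], rinner (c *: x) y <= rnorm c * K) ->
  rnorm '[x, y] <= K.
Proof.
move=> h; set z := '[x, y].
have [z0|z0] := eqVneq (rnorm z) 0.
  have := h 1%:C; have := h (-1)%:C; rewrite !rinnerZl !rnorm_realC normrN normr1 z0.
  lra.
have zp : 0 < rnorm z by rewrite lt0r z0 rnorm_ge0.
rewrite -(ler_pM2l zp).
have -> : rnorm z * rnorm z = rinner (Num.conj z *: x) y.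
  rewrite /rinner linearZl_LR /= -/z [X in complex.Re X]mulrC -normCK.
  by rewrite -rnormE -rmorphXn.
by apply: le_trans (h _) _; rewrite /rnorm norm_conjC.
Qed.

Lemma parallelogram x y :
  rnorm (x - y) ^+ 2 = 2 * (rnorm x ^+ 2 + rnorm y ^+ 2) - rnorm (x + y) ^+ 2.
Proof.
rewrite -!rinner_rnorm !(rinnerDl, rinnerDr, rinnerNl, rinnerNr) (rinnerC y x); ring.
Qed.

Lemma im_inner x y : complex.Im '[x, y] = - rinner ('i *: x) y.
Proof.
rewrite /rinner linearZl_LR /=; case: '[x, y] => u v /=.
by rewrite mul0r mul1r sub0r opprK.
Qed.

(** The imaginary part of a complex form is the real part at ['i *: x], so the
    real form determines the complex one. *)
Lemma inner_eq x y x' y' : rinner x y = rinner x' y' ->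
  rinner ('i *: x) y = rinner ('i *: x') y' -> '[x, y] = '[x', y'].
Proof.
move=> h1 h2; apply/eqP; rewrite eq_complex /= !im_inner h2 eqxx andbT.
exact/eqP.
Qed.

Lemma hilbert_complete (u : nat -> H) :
  (forall e : R, 0 < e -> exists N, forall n m, (N <= n)%N -> (N <= m)%N ->
     rnorm (u n - u m) < e) ->
  exists l, forall e : R, 0 < e -> \forall n \near \oo, rnorm (u n - l) < e.
Proof.
move=> uC.
have /cauchy_cvgP/cvg_ex[l ul] : cauchy (u @ \oo).
  apply/cauchyP => e e0.
  have er : e = (complex.Re e)%:C by rewrite RRe_real ?gtr0_real.
  have e0' : 0 < complex.Re e by rewrite -ltcR -er.
  have [N uN] := uC _ e0'.
  exists (u N); exists N => // n /= Nn.
  rewrite -ball_normE /ball_ /= er -rnormE ltcR; exact: uN.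
exists l => e e0.
have e0' : 0 < e%:C :> R[i] by rewrite ltcR.
have /cvgrPdist_lt/(_ _ e0')[N _ uN] := ul.
exists N => // n /= /uN; by rewrite -rnormE ltcR rnormB_sym.
Qed.

End RealInnerProduct.

(** * Riesz representation and adjoints *)

Lemma eventually_inv_lt (R : realType) (e : R) : 0 < e ->
  \forall n \near \oo, n.+1%:R^-1 < e.
Proof. by move=> e0; exact: (near_infty_natSinv_lt (PosNum e0)). Qed.

Section Adjoint.
Variables (R : realType) (H : hilbertType R).
Implicit Types (x y z : H) (a : R) (S T : 'B(H)).

(** The representing vector minimizes [F x = |x|^2 - 2 phi x], because
    [F x = |x - z|^2 - |z|^2] when [phi] is the product with [z].  The
    parallelogram identity shows that minimizing sequences are Cauchy; at their
    limit the derivative of [F] vanishes in every direction.  Real linearity is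
    enough, so the lemma applies directly to [x |-> Re <T x, y>]. *)
Lemma riesz (phi : H -> R) (C : R) :
    (forall x y, phi (x + y) = phi x + phi y) ->
    (forall a x, phi (a%:C *: x) = a * phi x) ->
    (forall x, `|phi x| <= C * rnorm x) ->
  exists z, forall x, phi x = rinner x z.
Proof.
move=> phiD phiZ phiC.
pose F x := rnorm x ^+ 2 - 2 * phi x.
have Flb : lbound (range F) (- C ^+ 2).
  move=> _ [x _ <-]; rewrite /F.
  have := sqr_ge0 (rnorm x - C); have := le_trans (ler_norm _) (phiC x); nra.
have Finf : has_inf (range F) by split; [exists (F 0), 0|exists (- C ^+ 2)].
pose m := inf (range F).
have Fm x : m <= F x by apply: ge_inf; [case: Finf|exists x].
have /choice[u Fu] : forall n : nat, exists x, F x < m + n.+1%:R^-1.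
  move=> n; have n0 : 0 < n.+1%:R^-1 :> R by rewrite invr_gt0 ltr0n.
  by have [_ [x _ <-] h] := inf_adherent n0 Finf; exists x.
(* The parallelogram identity, with [F >= m] at the midpoint. *)
have midF x y : rnorm (x - y) ^+ 2 <= 2 * F x + 2 * F y - 4 * m.
  have := Fm (2^-1%:C *: (x + y)).
  rewrite parallelogram /F phiZ phiD rnormZ rnorm_realC ger0_norm ?invr_ge0 //.
  rewrite exprMn; lra.
have [|l ul] := @hilbert_complete _ _ u.
  move=> e e0; have e2 : 0 < e ^+ 2 / 4 by rewrite divr_gt0 // exprn_gt0.
  have [N _ hN] := eventually_inv_lt e2.
  exists N => n k Nn Nk.
  rewrite -ltr_sqr ?nnegrE ?rnorm_ge0 ?(ltW e0) //.
  apply: le_lt_trans (midF _ _) _.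
  have := Fu n; have := Fu k; have /= := hN _ Nn; have /= := hN _ Nk.
  move: (k.+1%:R^-1) (n.+1%:R^-1) (F _) (F _) (e ^+ 2) => a b c d f; lra.
exists l => h.
pose D := rinner h l - phi h.
have Fexp x (s : R) : F (x + s%:C *: h) =
    F x + s ^+ 2 * rnorm h ^+ 2 + 2 * s * (rinner h x - phi h).
  rewrite /F phiD phiZ -!rinner_rnorm.
  rewrite !(rinnerDl, rinnerDr, rinnerZl, rinnerZr) (rinnerC x h).
  ring.
(* Moving from the limit [l] by [s h] does not decrease [F]; the right-hand side
   is the increment, and it is checked along the minimizing sequence. *)
have Dge (s : R) : 0 <= s ^+ 2 * rnorm h ^+ 2 + 2 * s * D.
  apply/ler_addgt0Pr => e e0.
  have K0 : 0 < 1 + 2 * `|s| * rnorm h.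
    by rewrite ltr_wpDr // !mulr_ge0 // rnorm_ge0.
  pose e' := e / (1 + 2 * `|s| * rnorm h).
  have e'0 : 0 < e' by rewrite divr_gt0.
  have ee' : e = e' + e' * (2 * `|s| * rnorm h).
    by rewrite -[X in X + _]mulr1 -mulrDr divfK // gt_eqF.
  near \oo => n.
  have h1 : n.+1%:R^-1 < e' by near: n; exact: eventually_inv_lt.
  have h2 : rnorm (u n - l) < e' by near: n; exact: ul.
  have h3 : s * rinner h (u n - l) <= e' * (`|s| * rnorm h).
    apply: le_trans (ler_norm _) _; rewrite normrM mulrCA ler_wpM2l //.
    apply: le_trans (rinner_cauchy_schwarz _ _) _.
    by rewrite mulrC ler_wpM2r ?rnorm_ge0 // ltW.
  have := Fm (u n + s%:C *: h); rewrite Fexp.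
  move: h1 h3 (Fu n); rewrite /D rinnerDr rinnerNr ee'.
  move: (n.+1%:R^-1) (F _) (rinner h _) (rinner h _) => i f r r'; lra.
have q1 : 0 < rnorm h ^+ 2 + 1 by rewrite ltr_wpDl // sqr_ge0.
(* A small step against the sign of [D] would decrease [F] unless [D = 0]; the
   [+ 1] keeps the denominator positive also for [h = 0]. *)
have := Dge (- D / (rnorm h ^+ 2 + 1)).
have -> : (- D / (rnorm h ^+ 2 + 1)) ^+ 2 * rnorm h ^+ 2 +
    2 * (- D / (rnorm h ^+ 2 + 1)) * D =
    - (D / (rnorm h ^+ 2 + 1)) ^+ 2 * (rnorm h ^+ 2 + 2).
  by field; rewrite gt_eqF.
rewrite mulNr oppr_ge0 pmulr_lle0; last by rewrite ltr_wpDl // sqr_ge0.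
move=> D0; have := sqr_ge0 (D / (rnorm h ^+ 2 + 1)).
move=> /(conj D0)/andP/le_anti/eqP.
rewrite expf_eq0 /= mulf_eq0 invr_eq0 (gt_eqF q1) orbF subr_eq0.
by move=> /eqP.
Unshelve. all: by end_near. Qed.

Lemma bopP T : linear T.
Proof. by have /bounded_opP[] := bop_valP T. Qed.

HB.instance Definition _ T := GRing.isLinear.Build R[i] H H *:%R T (bopP T).

Lemma bop_bounded T : exists2 M : R, 0 <= M & forall x, rnorm (T x) <= M * rnorm x.
Proof. by have /bounded_opP[] := bop_valP T. Qed.

Lemma rinner_conjZ c x y : rinner x (c *: y) = rinner (Num.conj c *: x) y.
Proof. by rewrite /rinner linearZ linearZl_LR. Qed.

(** [S y] represents [x |-> Re <T x, y>]; uniqueness of the representing vector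
    makes [S] complex linear, and [|S y|^2 = Re <T (S y), y>] bounds it by the
    bound of [T]. *)
Lemma adjoint_exists T :
  exists S : 'B(H), forall x y, '[T x, y] = '[x, S y].
Proof.
have [M M0 TM] := bop_bounded T.
have /choice[S TS] : forall y, exists z, forall x, rinner (T x) y = rinner x z.
  move=> y; apply: (@riesz (fun x => rinner (T x) y) (M * rnorm y)).
  - by move=> x x'; rewrite linearD rinnerDl.
  - by move=> a x; rewrite linearZ rinnerZl.
  - move=> x; apply: le_trans (rinner_cauchy_schwarz _ _) _.
    by rewrite mulrAC ler_wpM2r ?rnorm_ge0.
have Sb : S \in bounded_op (H:=H).
  apply/bounded_opP; split.
    move=> c y z; apply: rinner_ext => x.
    by rewrite rinnerDr rinner_conjZ -!TS linearZ/= rinnerDr rinner_conjZ.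
  exists M => // y.
  have [->|Sy] := eqVneq (rnorm (S y)) 0; first by rewrite mulr_ge0 ?rnorm_ge0.
  have Sy0 : 0 < rnorm (S y) by rewrite lt0r Sy rnorm_ge0.
  rewrite -(ler_pM2l Sy0) -expr2 -rinner_rnorm -TS.
  apply: le_trans (ler_norm _) _; apply: le_trans (rinner_cauchy_schwarz _ _) _.
  by rewrite mulrCA mulrA ler_wpM2r ?rnorm_ge0.
exists (Bop Sb) => x y /=; apply: inner_eq; first exact: TS.
by rewrite -TS linearZ.
Qed.

Lemma adjointP T x y : '[T x, y] = '[x, adjoint T y].
Proof.
rewrite /adjoint; case: xgetP => [S _ /= ->//|none].
by have [S TS] := adjoint_exists T; case: (none S).
Qed.

Lemma rinner_adjoint T x y : rinner (T x) y = rinner x (adjoint T y).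
Proof. by rewrite /rinner adjointP. Qed.

Lemma adjointK T : adjoint (adjoint T) = T.
Proof.
apply: val_inj; apply/funext => x /=; apply: rinner_ext => u.
by rewrite -rinner_adjoint rinnerC -rinner_adjoint rinnerC.
Qed.
End Adjoint.

(** * Operator norm and norm limits *)

Section OperatorNorm.
Variables (R : realType) (H : hilbertType R).
Implicit Types (x y z : H) (a e : R) (S T : 'B(H)).

Lemma bop_mulE S T x : (S * T) x = S (T x). Proof. by []. Qed.
Lemma bop_scaleE (c : R[i]) S x : (c *: S) x = c *: S x. Proof. by []. Qed.
Lemma bop_sumE (I : Type) (r : seq I) (P : pred I) (F : I -> 'B(H)) x :
  (\sum_(i <- r | P i) F i) x = \sum_(i <- r | P i) F i x.
Proof. by apply: (big_morph (fun T : 'B(H) => T x)). Qed.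

Lemma bop_ext S T : (forall x, S x = T x) -> S = T.
Proof. by move=> h; apply: val_inj; apply/funext. Qed.

Lemma opnorm_has_sup T :
  has_sup [set rnorm (T x) | x in [set x | rnorm x <= 1]].
Proof.
split; first by exists (rnorm (T 0)), 0 => //=; rewrite rnorm0.
have [M M0 TM] := bop_bounded T.
exists M => _ [x /= x1 <-]; apply: le_trans (TM x) _.
by rewrite -[leRHS]mulr1 ler_wpM2l.
Qed.

Lemma rnorm_bop_le T x : rnorm (T x) <= opnorm T * rnorm x.
Proof.
have [x0|x0] := eqVneq (rnorm x) 0.
  by rewrite x0 mulr0 (rnorm_eq0 x0) linear0 rnorm0.
have xp : 0 < rnorm x by rewrite lt0r x0 rnorm_ge0.
rewrite -ler_pdivrMr // mulrC; apply: sup_upper_bound; first exact: opnorm_has_sup.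
exists ((rnorm x)^-1%:C *: x) => /=.
  by rewrite rnormZ rnorm_realC ger0_norm ?invr_ge0 ?rnorm_ge0 // mulVf.
by rewrite linearZ rnormZ rnorm_realC ger0_norm ?invr_ge0 ?rnorm_ge0.
Qed.

Lemma opnorm_ge0 T : 0 <= opnorm T.
Proof.
apply: sup_upper_bound; first exact: opnorm_has_sup.
by exists 0; rewrite /= ?linear0 rnorm0.
Qed.

Lemma opnorm_le T C : 0 <= C -> (forall x, rnorm (T x) <= C * rnorm x) ->
  opnorm T <= C.
Proof.
move=> C0 h; apply: ge_sup; first by have [] := opnorm_has_sup T.
move=> _ [x /= x1 <-]; apply: le_trans (h x) _.
by rewrite -[leRHS]mulr1 ler_wpM2l.
Qed.

(** Convergence in operator norm ([oplimP]), in the form in which limits are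
    computed: a bound on vectors, uniform on the unit ball. *)
Definition oplim (T_ : nat -> 'B(H)) T := forall e, 0 < e ->
  \forall n \near \oo, forall x, rnorm (T_ n x - T x) <= e * rnorm x.

Lemma oplimP (T_ : nat -> 'B(H)) T :
  (fun n => opnorm (T_ n - T)) @ \oo --> (0 : R) <-> oplim T_ T.
Proof.
split=> [/cvgrPdist_le h e e0|h].
  have [N _ hN] := h _ e0; exists N => // n /hN /=.
  rewrite sub0r normrN ger0_norm ?opnorm_ge0 // => le x.
  by apply: le_trans (rnorm_bop_le (T_ n - T) x) _; rewrite ler_wpM2r ?rnorm_ge0.
apply/cvgrPdist_le => e e0; have [N _ hN] := h _ e0; exists N => // n /hN /= le.
rewrite sub0r normrN ger0_norm ?opnorm_ge0 //.
by apply: opnorm_le; rewrite ?ltW.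
Qed.

(** The limit is constructed pointwise; it is linear and bounded because it is
    within [e |x|] of some [T_ n], uniformly in [x]. *)
Lemma oplim_complete (T_ : nat -> 'B(H)) :
    (forall e, 0 < e -> exists N, forall n m, (N <= n)%N -> (N <= m)%N ->
       forall x, rnorm (T_ n x - T_ m x) <= e * rnorm x) ->
  exists T, oplim T_ T.
Proof.
move=> TC.
have /choice[f fT] : forall x, exists l, forall e, 0 < e ->
    \forall n \near \oo, rnorm (T_ n x - l) < e.
  move=> x; apply: hilbert_complete => e e0.
  have x1 : 0 < rnorm x + 1 by rewrite ltr_wpDl ?rnorm_ge0.
  have [|N hN] := TC (e / (rnorm x + 1)); first exact: divr_gt0.
  exists N => n m Nn Nm; apply: le_lt_trans (hN n m Nn Nm x) _.
  by rewrite mulrAC ltr_pdivrMr // ltr_pM2l // ltrDl.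
have fapprox e : 0 < e -> exists N, forall n, (N <= n)%N ->
    forall x, rnorm (T_ n x - f x) <= e * rnorm x.
  move=> e0; have [N hN] := TC e e0; exists N => n Nn x.
  apply/ler_addgt0Pr => d d0.
  near \oo => m.
  apply: le_trans (rnorm_triangle (T_ m x) _ _) _; apply: lerD.
    by apply: hN => //; near: m; exists N.
  by apply: ltW; near: m; exact: fT.
have fb : f \in bounded_op (H:=H).
  apply/bounded_opP; split.
    move=> c x y; apply/eqP; rewrite -subr_eq0; apply/eqP/rnorm_eq0/le_anti.
    rewrite rnorm_ge0 andbT; apply/ler_addgt0Pr => e e0; rewrite add0r.
    have c3 : 0 < rnorm c + 2 by rewrite ltr_wpDl ?rnorm_ge0.
    have e3 : 0 < e / (rnorm c + 2) by rewrite divr_gt0.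
    near \oo => n.
    apply: le_trans (rnorm_triangle (T_ n (c *: x + y)) _ _) _.
    have -> : e = e / (rnorm c + 2) + (rnorm c * (e / (rnorm c + 2)) +
      e / (rnorm c + 2)) by field; rewrite gt_eqF.
    apply: lerD; first by rewrite rnormB_sym; apply: ltW; near: n; exact: fT.
    rewrite linearP opprD addrACA -scalerBr.
    apply: le_trans (rnormD _ _) _; rewrite rnormZ; apply: lerD.
      by apply: ler_wpM2l; [exact: rnorm_ge0|apply: ltW; near: n; exact: fT].
    by apply: ltW; near: n; exact: fT.
  have [N hN] := fapprox 1 ltr01.
  have [M M0 TM] := bop_bounded (T_ N).
  exists (1 + M) => [|x]; first exact: addr_ge0.
  rewrite -[f x](subKr (T_ N x)); apply: le_trans (rnormD _ _) _.
  by rewrite rnormN mulrDl addrC lerD // hN.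
exists (Bop fb) => e /fapprox[N hN]; exists N => // n Nn x; exact: hN.
Unshelve. all: by end_near. Qed.

Lemma oplim_unique (T_ : nat -> 'B(H)) S T : oplim T_ S -> oplim T_ T -> S = T.
Proof.
move=> TS TT; apply: bop_ext => x; apply/eqP; rewrite -subr_eq0.
apply/eqP/rnorm_eq0/le_anti; rewrite rnorm_ge0 andbT.
apply/ler_addgt0Pr => e e0; rewrite add0r.
have x1 : 0 < 2 * (rnorm x + 1) by rewrite mulr_gt0 // ltr_wpDl ?rnorm_ge0.
have := divr_gt0 e0 x1; set d := e / _ => d0.
have [N _ hN] := TS _ d0; have [K _ hK] := TT _ d0.
apply: le_trans (rnorm_triangle (T_ (maxn N K) x) _ _) _; rewrite rnormB_sym.
apply: le_trans (lerD (hN _ (leq_maxl _ _) x) (hK _ (leq_maxr _ _) x)) _.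
have -> : e = 2 * d * (rnorm x + 1) by rewrite /d; field; lra.
by rewrite mulrDr; lra.
Qed.

Lemma oplim_cst T : oplim (fun _ => T) T.
Proof.
move=> e e0; exists 0 => // n _ x; rewrite subrr rnorm0 mulr_ge0 ?rnorm_ge0 //.
exact: ltW.
Qed.

Lemma oplim_sub (S_ T_ : nat -> 'B(H)) S : oplim S_ S ->
  oplim (fun n => T_ n - S_ n) 0 -> oplim T_ S.
Proof.
move=> SS TS e e0; have e2 : 0 < e / 2 by rewrite divr_gt0.
have [N _ hN] := SS _ e2; have [K _ hK] := TS _ e2.
exists (maxn N K) => // n; rewrite /= geq_max => /andP[/hN h1 /hK h2] x.
apply: le_trans (rnorm_triangle (S_ n x) _ _) _.
rewrite [e]splitr mulrDl lerD //.
by have := h2 x; rewrite subr0.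
Qed.

Lemma oplim_mul (S_ T_ : nat -> 'B(H)) S T : oplim S_ S -> oplim T_ T ->
  oplim (fun n => S_ n * T_ n) (S * T).
Proof.
move=> SS TT e e0.
have [M M0 SM] := bop_bounded S; have [K K0 TK] := bop_bounded T.
pose d := e / (M + 1 + K).
have D0 : 0 < M + 1 + K by rewrite ltr_wpDr // ltr_wpDl.
have d0 : 0 < d by rewrite divr_gt0.
have [N1 _ h1] := SS _ d0; have [N2 _ h2] := TT _ d0.
have [N3 _ h3] := SS _ ltr01.
exists (maxn N1 (maxn N2 N3)) => // n.
rewrite /= !geq_max => /and3P[/h1 {}h1 /h2 {}h2 /h3 {}h3] x.
change (rnorm (S_ n (T_ n x) - S (T x)) <= e * rnorm x).
apply: le_trans (rnorm_triangle (S_ n (T x)) _ _) _.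
rewrite -(linearB (S_ n)).
have -> : e * rnorm x = (M + 1) * (d * rnorm x) + d * (K * rnorm x).
  by rewrite /d; field; lra.
have Sn y : rnorm (S_ n y) <= (M + 1) * rnorm y.
  rewrite -[S_ n y](subrK (S y)); apply: le_trans (rnormD _ _) _.
  by rewrite addrC mulrDl lerD.
apply: lerD.
  apply: le_trans (Sn _) _; rewrite ler_wpM2l //; exact: addr_ge0.
apply: le_trans (h1 _) _; rewrite ler_wpM2l //; exact: ltW.
Qed.

End OperatorNorm.

(** * Polynomials that are nonnegative on an interval *)

Section PolynomialCone.
Variables (R : realType).
Implicit Types (p q r s : {poly R}) (M x : R).

(** Continuity from one side: it serves at the end points [0] and [M] as well as
    at interior points, where both sides are used. *)
Lemma poly_ge0_limit p (a b : R) :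
  (forall t, 0 < t -> t <= 1 -> 0 <= p.[a + t * (b - a)]) -> 0 <= p.[a].
Proof.
move=> h; pose g := p \Po (a%:P + (b - a)%:P * 'X).
have gE t : g.[t] = p.[a + t * (b - a)].
  by rewrite horner_comp !hornerE mulrC.
have -> : p.[a] = g.[0] by rewrite gE mul0r addr0.
apply: (@cvgr_to_ge _ (0^'+) _ _ (horner g)).
  by apply: cvg_at_right_filter; exact: continuous_horner.
near=> t; rewrite gE; apply: h; near: t; first exact: nbhs_right_gt.
exact: nbhs_right_le.
Unshelve. all: by end_near. Qed.

(** The weighted sums of squares generated by [1], ['X] and [M - 'X]: their
    nonnegativity on [[0, M]] is visible from the way they are built, hence is
    inherited when ['X] is replaced by an operator between [0] and [M]. *)
Inductive cone M : {poly R} -> Prop :=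
| cone_sq s : cone M (s ^+ 2)
| cone_X s : cone M ('X * s ^+ 2)
| cone_MX s : cone M ((M%:P - 'X) * s ^+ 2)
| cone_add p q : cone M p -> cone M q -> cone M (p + q).

Lemma cone_mul_sq M p r : cone M p -> cone M (p * r ^+ 2).
Proof.
elim=> {p} [s|s|s|p q _ hp _ hq]; last by rewrite mulrDl; exact: cone_add.
- by rewrite -exprMn; exact: cone_sq.
- by rewrite -mulrA -exprMn; exact: cone_X.
- by rewrite -mulrA -exprMn; exact: cone_MX.
Qed.

(** The product of the two weights is again in the cone since
    [M x (M - x) = x (M - x)^2 + (M - x) x^2]. *)
Lemma cone_XMX M s : 0 < M -> cone M ('X * (M%:P - 'X) * s ^+ 2).
Proof.
move=> M0; pose t : R := Num.sqrt M^-1.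
have tM : t%:P ^+ 2 * M%:P = 1.
  by rewrite -rmorphXn /= sqr_sqrtr ?invr_ge0 ?ltW // -polyCM mulVf ?gt_eqF.
have -> : 'X * (M%:P - 'X) * s ^+ 2 =
    'X * ((M%:P - 'X) * (s * t%:P)) ^+ 2 +
    (M%:P - 'X) * ('X * (s * t%:P)) ^+ 2.
  rewrite -[LHS]mulr1 -tM; ring.
by apply: cone_add; [exact: cone_X|exact: cone_MX].
Qed.

Lemma cone_mul_X M p : 0 < M -> cone M p -> cone M ('X * p).
Proof.
move=> M0; elim=> {p} [s|s|s|p q _ hp _ hq]; last by rewrite mulrDr; exact: cone_add.
- exact: cone_X.
- by rewrite mulrA -expr2 -exprMn; exact: cone_sq.
- by rewrite mulrA; exact: cone_XMX.
Qed.

Lemma cone_mul_MX M p : 0 < M -> cone M p -> cone M ((M%:P - 'X) * p).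
Proof.
move=> M0; elim=> {p} [s|s|s|p q _ hp _ hq]; last by rewrite mulrDr; exact: cone_add.
- exact: cone_MX.
- by rewrite mulrA [(_ - _) * 'X]mulrC; exact: cone_XMX.
- by rewrite mulrA -expr2 -exprMn; exact: cone_sq.
Qed.

Lemma cone_nonneg_const M (c : R) : 0 <= c -> cone M c%:P.
Proof. by move=> c0; rewrite -(sqr_sqrtr c0) rmorphXn; exact: cone_sq. Qed.

Lemma size_mul_XsubC_le p q (c : R) n : (size p <= n.+1)%N ->
  p = q * ('X - c%:P) -> (size q <= n)%N.
Proof.
move=> pn pq; have [->|q0] := eqVneq q 0; first by rewrite size_poly0.
move: pn; rewrite pq size_Mmonic ?monicXsubC //.
by rewrite size_XsubC addn2.
Qed.

(** Induction on the degree.  Subtracting the minimum of [p] on [[0, M]], itself a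
    nonnegative constant, leaves a nonnegative polynomial with a root [c] in
    [[0, M]].  At an end point the factor ['X] or [M - 'X] splits off; at an
    interior point the root is double and [('X - c)^2] splits off.  Having a root
    in the interval at each stage makes complex roots unnecessary. *)
Theorem nonneg_poly_cone M p : 0 < M ->
  (forall x, 0 <= x <= M -> 0 <= p.[x]) -> cone M p.
Proof.
move=> M0; have [n] := ubnPleq (size p); elim: n p => [|n IHn] p pn p0.
  move: pn; rewrite leqn0 size_poly_eq0 => /eqP ->.
  by have := cone_sq M 0; rewrite expr0n.
have [|c] := @EVT_min _ (horner p) 0 M (ltW M0).
  by apply: continuous_subspaceT => x; exact: continuous_horner.
rewrite in_itv /= => /andP[c0 cM] cmin.
set m := p.[c] in cmin.
have m0 : 0 <= m by apply: p0; rewrite c0.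
have /factor_theorem[q pq] : root (p - m%:P) c.
  by rewrite /root !hornerE subrr.
have qn : (size q <= n)%N.
  apply: size_mul_XsubC_le pq; apply: leq_trans (size_polyD _ _) _.
  rewrite geq_max pn size_polyN; apply: leq_trans (size_polyC_leq1 _) _.
  by [].
have qs x : 0 <= x <= M -> 0 <= q.[x] * (x - c).
  move=> xM; have := cmin x; rewrite in_itv /= => /(_ xM).
  rewrite -subr_ge0; have <- : (p - m%:P).[x] = p.[x] - m by rewrite !hornerE.
  by rewrite pq !hornerE.
have -> : p = q * ('X - c%:P) + m%:P by rewrite -pq subrK.
apply: cone_add; last exact: cone_nonneg_const.
(* Dividing by a factor that vanishes at [c] loses the sign at [c] itself; it
   is recovered by continuity. *)
have fill r : (forall x, 0 <= x <= M -> x != c -> 0 <= r.[x]) ->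
    forall x, 0 <= x <= M -> 0 <= r.[x].
  move=> rc x xM; have [->|] := eqVneq x c; last exact: rc.
  have [cltM|Mlec] := ltP c M.
    apply: (@poly_ge0_limit _ _ M) => t t0 t1; apply: rc.
      apply/andP; split; nra.
    by rewrite gt_eqF // ltrDl mulr_gt0 // subr_gt0.
  apply: (@poly_ge0_limit _ _ 0) => t t0 t1; apply: rc.
    apply/andP; split; nra.
  by rewrite lt_eqF // gtrDl pmulr_rlt0 //; lra.
have [c00|c_gt0] := leP c 0; last have [Mc|cltM] := leP M c.
- have {}c0 : c = 0 by apply/le_anti; rewrite c0 c00.
  rewrite c0 subr0 mulrC; apply: cone_mul_X => //; apply: IHn => //.
  apply: fill => x /andP[x0 xM] xc; have := qs x; rewrite x0 xM c0 subr0.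
  by move=> /(_ isT); rewrite pmulr_lge0 // lt0r x0 andbT -c0.
- have {}cM : c = M by apply/le_anti; rewrite cM Mc.
  rewrite cM -mulrNN opprB mulrC; apply: cone_mul_MX => //; apply: IHn.
    by rewrite size_polyN.
  apply: fill => x /andP[x0 xM] xc; have := qs x; rewrite x0 xM => /(_ isT).
  rewrite hornerN oppr_ge0 nmulr_lge0 // subr_lt0 lt_neqAle xc cM.
  by [].
have q_ge x : c < x -> x <= M -> 0 <= q.[x].
  move=> cx xM; have := qs x; rewrite xM andbT (le_trans c0 (ltW cx)).
  by move=> /(_ isT); rewrite pmulr_lge0 // subr_gt0.
have q_le x : x < c -> 0 <= x -> q.[x] <= 0.
  move=> xc x0; have := qs x; rewrite x0 (le_trans (ltW xc) cM).
  by move=> /(_ isT); rewrite nmulr_lge0 // subr_lt0.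
(* The quotient changes sign at the interior point [c]. *)
have /factor_theorem[r qr] : root q c.
  apply/eqP/le_anti/andP; split.
    rewrite -oppr_ge0 -hornerN; apply: (@poly_ge0_limit _ _ 0) => t t0 t1.
    rewrite hornerN oppr_ge0 q_le //; nra.
  apply: (@poly_ge0_limit _ _ M) => t t0 t1; apply: q_ge; nra.
rewrite qr -mulrA -expr2; apply: cone_mul_sq; apply: IHn.
  by apply: size_mul_XsubC_le qr; apply: leq_trans qn _.
apply: fill => x xM xc; have := qs x xM; rewrite qr !hornerE -mulrA.
by rewrite -expr2 pmulr_lge0 // exprn_even_gt0 //= subr_eq0.
Qed.
End PolynomialCone.

(** * Polynomials of a positive operator *)

Section PolynomialCalculus.
Variables (R : realType) (H : hilbertType R).
Implicit Types (x y z : H) (a e M : R) (S T A : 'B(H)) (p q : {poly R}).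

Lemma bop_scaleAl (c : R[i]) S T : (c *: S) * T = c *: (S * T).
Proof. exact: bop_ext. Qed.

Lemma bop_scaleAr (c : R[i]) S T : S * (c *: T) = c *: (S * T).
Proof. by apply: bop_ext => x; rewrite !bop_mulE !bop_scaleE bop_mulE linearZ. Qed.

Lemma poly_op_widen n p T : (size p <= n)%N ->
  poly_op p T = \sum_(i < n) (p`_i)%:C *: T ^+ i.
Proof.
move=> pn; rewrite /poly_op (big_ord_widen n (fun i => (p`_i)%:C *: T ^+ i)) //.
rewrite big_mkcond; apply: eq_bigr => i _.
by case: ltnP => // /(nth_default 0) ->; rewrite scale0r.
Qed.

Lemma poly_opD p q T : poly_op (p + q) T = poly_op p T + poly_op q T.
Proof.
pose n := maxn (size p) (size q).
rewrite !(@poly_op_widen n) ?leq_maxl ?leq_maxr ?size_polyD //.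
by rewrite -big_split; apply: eq_bigr => i _; rewrite coefD rmorphD scalerDl.
Qed.

Lemma poly_opCM a p T : poly_op (a%:P * p) T = a%:C *: poly_op p T.
Proof.
rewrite (@poly_op_widen (size p)); last first.
  by rewrite mul_polyC; exact: size_scale_leq.
by rewrite scaler_sumr; apply: eq_bigr => i _; rewrite coefCM rmorphM scalerA.
Qed.

Lemma poly_opN p T : poly_op (- p) T = - poly_op p T.
Proof. by rewrite -mulN1r -polyCN poly_opCM rmorphN scaleN1r. Qed.

Lemma poly_op0 T : poly_op 0 T = 0.
Proof. by rewrite /poly_op size_poly0 big_ord0. Qed.

Lemma poly_op1 T : poly_op 1 T = 1.
Proof.
by rewrite /poly_op size_poly1 big_ord1 coef1 scale1r expr0.
Qed.

Lemma poly_opC a T : poly_op a%:P T = a%:C *: (1 : 'B(H)).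
Proof. by rewrite -[a%:P]mulr1 poly_opCM poly_op1. Qed.

Lemma poly_opMX p T : poly_op (p * 'X) T = poly_op p T * T.
Proof.
rewrite (@poly_op_widen (size p).+1); last first.
  have [->|p0] := eqVneq p 0; first by rewrite mul0r size_poly0.
  by rewrite size_mulX.
rewrite big_ord_recl coefMX scale0r add0r mulr_suml.
by apply: eq_bigr => i _; rewrite coefMX /= bop_scaleAl exprSr.
Qed.

Lemma poly_opX T : poly_op 'X T = T.
Proof. by rewrite -['X]mul1r poly_opMX poly_op1 mul1r. Qed.

Lemma poly_opM p q T : poly_op (p * q) T = poly_op p T * poly_op q T.
Proof.
elim/poly_ind: q => [|q c IHq]; first by rewrite mulr0 poly_op0 mulr0.
rewrite mulrDr mulrA !poly_opD !poly_opMX IHq mulrDr mulrA [p * _]mulrC.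
by rewrite poly_opCM poly_opC bop_scaleAr mulr1.
Qed.

(** The algebraic core of [absop_intertwine] and of the mixed Schwarz inequality:
    a relation [A S = T A] extends to all polynomials. *)
Lemma intertwine_poly A S T p : A * S = T * A -> A * poly_op p S = poly_op p T * A.
Proof.
move=> AST; elim/poly_ind: p => [|p c IHp].
  by rewrite !poly_op0 mulr0 mul0r.
rewrite !poly_opD !poly_opMX !poly_opC mulrDr mulrDl mulrA IHp -!mulrA AST.
by rewrite bop_scaleAr bop_scaleAl mulr1 mul1r.
Qed.

Definition selfadjoint S := forall x y, rinner (S x) y = rinner x (S y).

Lemma selfadjoint_poly_op S p : selfadjoint S -> selfadjoint (poly_op p S).
Proof.
move=> Ss; elim/poly_ind: p => [|p c IHp] x y.
  by rewrite poly_op0 /rinner linear0l linear0r.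
rewrite poly_opD rinnerDl rinnerDr; congr (_ + _).
  by rewrite {1}mulrC !poly_opM poly_opX Ss IHp.
by rewrite poly_opC rinnerZl rinnerZr.
Qed.

Definition positive_op S := selfadjoint S /\ forall x, 0 <= rinner (S x) x.

(** The bound is on the quadratic form: it is what the weight [M - 'X] of [cone]
    needs. *)
Definition pos_bounded M S := [/\ selfadjoint S, forall x, 0 <= rinner (S x) x &
  forall x, rinner (S x) x <= M * rnorm x ^+ 2].

(** Each generator [w s^2] gives [<w(S) s(S) x, s(S) x>], where [w(S)] is the
    identity, [S] or [M - S]. *)
Lemma cone_poly_op_ge0 M S p : pos_bounded M S -> cone M p ->
  forall x, 0 <= rinner (poly_op p S x) x.
Proof.
move=> [Ss S0 SM]; elim=> {p} [s|s|s|p q _ hp _ hq] x.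
- rewrite expr2 poly_opM (selfadjoint_poly_op _ Ss) rinner_rnorm; exact: sqr_ge0.
- rewrite expr2 mulrCA !poly_opM poly_opX (selfadjoint_poly_op _ Ss); exact: S0.
- rewrite expr2 mulrCA !poly_opM poly_opD poly_opN poly_opX poly_opC.
  rewrite (selfadjoint_poly_op _ Ss); set y := poly_op s S x.
  change (0 <= rinner (M%:C *: y - S y) y).
  by rewrite rinnerDl rinnerNl rinnerZl rinner_rnorm subr_ge0.
- by rewrite poly_opD rinnerDl addr_ge0 ?hp ?hq.
Qed.

(** The form of [S] vanishes; polarizing it at [x + S x] gives [2 |S x|^2 = 0]. *)
Lemma pos_bounded0 S : pos_bounded 0 S -> S = 0.
Proof.
move=> [Ss S0 SM]; apply: bop_ext => x.
have Sxx u : rinner (S u) u = 0.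
  by apply/le_anti; rewrite S0 andbT -(mul0r (rnorm u ^+ 2)).
have := Sxx (x + S x).
rewrite linearD !rinnerDl !rinnerDr !Sxx (Ss (S x) x) rinner_rnorm.
rewrite addr0 add0r => /eqP.
by rewrite -mulr2n mulrn_eq0 /= expf_eq0 => /eqP /rnorm_eq0.
Qed.

(** Stands in for the spectral theorem: polynomials converging uniformly on
    [[0, M]] have norm-convergent values at [S]. *)
Lemma poly_op_contraction M S p e : 0 <= M -> pos_bounded M S -> 0 <= e ->
    (forall t, 0 <= t <= M -> `|p.[t]| <= e) ->
  forall x, rnorm (poly_op p S x) <= e * rnorm x.
Proof.
move=> M0 SM e0 pe x; have [MM|Mp] := leP M 0.
  (* Here [S = 0], so that only [p.[0]] matters. *)
  have {}M0 : M = 0 by apply/le_anti; rewrite M0 MM.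
  move: SM; rewrite M0 => /pos_bounded0 ->; move: pe; rewrite M0.
  elim/poly_ind: p => [|p c _] /(_ 0); rewrite lexx => /(_ isT).
    by rewrite poly_op0 rnorm0 mulr_ge0 ?rnorm_ge0.
  rewrite !hornerE ?mulr0 ?add0r poly_opD poly_opMX mulr0 add0r poly_opC => ce.
  change (rnorm (c%:C *: x) <= e * rnorm x).
  by rewrite rnormZ rnorm_realC ler_wpM2r ?rnorm_ge0.
have [Ss _ _] := SM.
(* [e^2 - p(S)^2 >= 0] says exactly that [|p(S) x|^2 <= e^2 |x|^2]. *)
have : cone M ((e ^+ 2)%:P - p * p).
  apply: nonneg_poly_cone => // t /pe; rewrite !hornerE => pt.
  by rewrite subr_ge0 -expr2 -[leLHS]real_normK ?num_real // lerXn2r ?nnegrE.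
move=> /(cone_poly_op_ge0 SM)/(_ x).
rewrite poly_opD poly_opN poly_opC poly_opM.
change (0 <= rinner ((e ^+ 2)%:C *: x - poly_op p S (poly_op p S x)) x -> 
  rnorm (poly_op p S x) <= e * rnorm x).
rewrite rinnerDl rinnerNl rinnerZl (selfadjoint_poly_op _ Ss) !rinner_rnorm.
rewrite subr_ge0 -exprMn.
by rewrite ler_sqr // nnegrE ?mulr_ge0 ?rnorm_ge0.
Qed.

Lemma positive_op_bounded M S : positive_op S -> opnorm S <= M ->
  pos_bounded M S.
Proof.
move=> [Ss S0] SM; split=> // x.
apply: le_trans (ler_norm _) _; apply: le_trans (rinner_cauchy_schwarz _ _) _.
rewrite expr2 mulrA ler_wpM2r ?rnorm_ge0 //.
by apply: le_trans (rnorm_bop_le S x) _; rewrite ler_wpM2r ?rnorm_ge0.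
Qed.

End PolynomialCalculus.

(** * Uniform polynomial approximation of powers *)

Section PolynomialApproximation.
Variables (R : realType).
Implicit Types (f g : R -> R) (phi psi : nat -> R) (a e M t : R).

Definition poly_ulim M (p : nat -> {poly R}) f := forall e, 0 < e ->
  \forall n \near \oo, forall t, 0 <= t <= M -> `|(p n).[t] - f t| <= e.

(** The Bernstein polynomial [sum_k phi k 'C(n, k) 'X^k (1 - 'X)^(n - k)], given by
    the recursion that conditions on the first of [n] coin tosses: its value at
    [t] is the expectation of [phi] at a binomial variable.  The recursion makes
    positivity and moments immediate inductions, without binomial sums. *)
Fixpoint bernstein n phi : {poly R} :=
  if n is n'.+1 then
    (1 - 'X) * bernstein n' phi + 'X * bernstein n' (fun k => phi k.+1)
  else (phi 0)%:P.

Lemma bernsteinS n phi t : (bernstein n.+1 phi).[t] =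
  (1 - t) * (bernstein n phi).[t] + t * (bernstein n (fun k => phi k.+1)).[t].
Proof. by rewrite /= !hornerE. Qed.

Lemma bernstein_affine n phi a c t :
  (bernstein n (fun k => a * phi k + c)).[t] = a * (bernstein n phi).[t] + c.
Proof.
elim: n phi => [|n IHn] phi; first by rewrite /= !hornerC.
rewrite !bernsteinS !IHn; ring.
Qed.

Lemma bernstein_le n phi psi t : 0 <= t <= 1 ->
    (forall k, (k <= n)%N -> phi k <= psi k) ->
  (bernstein n phi).[t] <= (bernstein n psi).[t].
Proof.
move=> /andP[t0 t1]; elim: n phi psi => [|n IHn] phi psi le.
  by rewrite /= !hornerC le.
rewrite !bernsteinS; apply: lerD; apply: ler_wpM2l; rewrite ?subr_ge0 //.
  by apply: IHn => k kn; rewrite le // ltnW.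
by apply: IHn => k kn; rewrite le.
Qed.

(** The second moment about [c] of the binomial variable. *)
Lemma bernstein_variance n c t :
  (bernstein n (fun k => (k%:R - c) ^+ 2)).[t] =
  n%:R * (t * (1 - t)) + (n%:R * t - c) ^+ 2.
Proof.
elim: n c => [|n IHn] c; first by rewrite /= hornerC; ring.
rewrite bernsteinS IHn.
have -> : bernstein n (fun k => (k.+1%:R - c) ^+ 2) =
    bernstein n (fun k => (k%:R - (c - 1)) ^+ 2).
  by congr bernstein; apply/funext => k; rewrite -natr1; ring.
rewrite IHn -natr1; ring.
Qed.

(** Chebyshev's argument: [|f (k / n) - f t|] is at most [e] when [k / n] is
    within [d] of [t], and otherwise at most [2 F (k / n - t)^2 / d^2], whose
    expectation is the variance [t (1 - t) / n] times [2 F / d^2]. *)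
Lemma bernstein_approx f F e d n t : 0 <= t <= 1 -> 0 < d -> 0 <= e ->
    (forall s, 0 <= s <= 1 -> `|s - t| < d -> `|f s - f t| <= e) ->
    (forall s, 0 <= s <= 1 -> `|f s| <= F) ->
  `|(bernstein n.+1 (fun k => f (k%:R / n.+1%:R))).[t] - f t| <=
    e + 2 * F / d ^+ 2 * n.+1%:R^-1.
Proof.
move=> t01 d0 e0 fd fF.
have F0 : 0 <= F by apply: le_trans (fF _ t01).
pose N : R := n.+1%:R; have N0 : 0 < N by rewrite ltr0n.
pose C := 2 * F / d ^+ 2; have C0 : 0 <= C by rewrite !mulr_ge0 // invr_ge0 sqr_ge0.
have pointwise k : (k <= n.+1)%N ->
    `|f (k%:R / N) - f t| <= C / N ^+ 2 * (k%:R - N * t) ^+ 2 + e.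
  move=> kn; set s := k%:R / N.
  have s01 : 0 <= s <= 1.
    by rewrite divr_ge0 ?(ltW N0) //= ler_pdivrMr // mul1r ler_nat.
  have -> : C / N ^+ 2 * (k%:R - N * t) ^+ 2 = C * (s - t) ^+ 2.
    by rewrite /s; field; rewrite gt_eqF.
  have [near_t|far] := ltP `|s - t| d.
    by apply: le_trans (fd _ s01 near_t) _; rewrite lerDr mulr_ge0 ?sqr_ge0.
  apply: (@le_trans _ _ (2 * F)).
    apply: le_trans (ler_normB _ _) _.
    by rewrite mulr_natl mulr2n lerD // fF.
  rewrite -[leLHS]addr0 lerD // /C mulrAC ler_pdivlMr ?exprn_gt0 //.
  rewrite ler_wpM2l ?mulr_ge0 // -[leRHS]real_normK ?num_real //.
  by rewrite lerXn2r // nnegrE // ltW.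
have var_le : C / N ^+ 2 * (bernstein n.+1 (fun k => (k%:R - N * t) ^+ 2)).[t] + e
    <= e + C * N^-1.
  rewrite bernstein_variance -/N subrr expr0n addr0 addrC lerD2l.
  have -> : C / N ^+ 2 * (N * (t * (1 - t))) = C * N^-1 * (t * (1 - t)).
    by field; rewrite gt_eqF.
  rewrite -[leRHS]mulr1 ler_wpM2l ?divr_ge0 ?(ltW N0) //; move: t01; nra.
set phi := fun k => f (k%:R / n.+1%:R).
(* Both signs of the error are handled at once with [a = 1] and [a = -1]. *)
suff bound a : `|a| = 1 ->
    a * (bernstein n.+1 phi).[t] + - (a * f t) <= e + C * N^-1.
  rewrite -/N -/C; move: (_ / N) bound => K bound.
  rewrite ler_norml; apply/andP; split.
    by have := bound (-1); rewrite normrN1 => /(_ erefl); lra.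
  by have := bound 1; rewrite normr1 => /(_ erefl); lra.
move=> a1; rewrite -bernstein_affine; apply: le_trans var_le.
rewrite -bernstein_affine; apply: bernstein_le => // k /pointwise.
apply: le_trans; rewrite -mulrBr; apply: le_trans (ler_norm _) _.
by rewrite normrM a1 mul1r.
Qed.

Lemma bernstein_ulim f F :
    (forall e, 0 < e -> exists2 d, 0 < d & forall s t, 0 <= s <= 1 ->
       0 <= t <= 1 -> `|s - t| < d -> `|f s - f t| <= e) ->
    (forall s, 0 <= s <= 1 -> `|f s| <= F) ->
  poly_ulim 1 (fun n => bernstein n.+1 (fun k => f (k%:R / n.+1%:R))) f.
Proof.
move=> fu fF e e0; have e2 : 0 < e / 2 by rewrite divr_gt0.
have [d d0 fd] := fu _ e2.
have F0 : 0 <= F by apply: le_trans (fF 0 _); rewrite ?lexx /=.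
pose K := 2 * F / d ^+ 2 + 1.
have K0 : 0 < K by rewrite ltr_wpDl // !mulr_ge0 // invr_ge0 sqr_ge0.
near=> n => t t01.
apply: le_trans (@bernstein_approx f F _ d n t t01 d0 (ltW e2) _ fF) _.
  by move=> s s01; exact: fd.
rewrite {2}[e]splitr lerD2l.
apply: (@le_trans _ _ (K * n.+1%:R^-1)).
  by rewrite ler_wpM2r ?invr_ge0 // lerDl.
rewrite mulrC -ler_pdivlMr //; apply: ltW; near: n.
by apply: eventually_inv_lt; rewrite !divr_gt0.
Unshelve. all: by end_near. Qed.

Lemma poly_ulim_le M M' p f : M <= M' -> poly_ulim M' p f -> poly_ulim M p f.
Proof.
move=> MM pf e /pf[N _ h]; exists N => // n /h pn t /andP[t0 tM].
by apply: pn; rewrite t0 (le_trans tM).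
Qed.

Lemma poly_ulim_ext M p f g : (forall t, 0 <= t <= M -> f t = g t) ->
  poly_ulim M p f -> poly_ulim M p g.
Proof.
move=> fg pf e /pf[N _ h]; exists N => // n /h pn t tM.
by rewrite -fg // pn.
Qed.

Lemma poly_ulim_cst M (p : {poly R}) : poly_ulim M (fun _ => p) (horner p).
Proof. by move=> e e0; exists 0 => // n _ t _; rewrite subrr normr0 ltW. Qed.

Lemma poly_bounded M (p : {poly R}) : exists2 K : R, 0 <= K &
  forall t, 0 <= t <= M -> `|p.[t]| <= K.
Proof.
have [M0|M0] := leP 0 M; last first.
  by exists 0 => // t /andP[t0 /(le_trans t0)]; rewrite leNgt M0.
elim/poly_ind: p => [|p c [K K0 pK]].
  by exists 0 => // t _; rewrite horner0 normr0.
exists (K * M + `|c|) => [|t tM]; first by rewrite addr_ge0 ?mulr_ge0.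
rewrite !hornerE; apply: le_trans (ler_normD _ _) _; rewrite lerD2r normrM.
by case/andP: (tM) => t0 tM'; rewrite ler_pM // ?pK // ger0_norm.
Qed.

Lemma poly_ulim_bounded M p f : poly_ulim M p f ->
  exists2 K : R, 0 <= K & forall t, 0 <= t <= M -> `|f t| <= K.
Proof.
move=> /(_ 1 ltr01)[N _ /(_ N (leqnn _)) /= h].
have [K K0 pK] := poly_bounded M (p N).
exists (K + 1) => [|t tM]; first exact: addr_ge0.
rewrite -[f t](subKr (p N).[t]); apply: le_trans (ler_normB _ _) _.
by rewrite lerD ?pK ?h.
Qed.

Lemma poly_ulim_mul M p q f g : poly_ulim M p f -> poly_ulim M q g ->
  poly_ulim M (fun n => p n * q n) (fun t => f t * g t).
Proof.
move=> pf qg e e0.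
have [A A0 fA] := poly_ulim_bounded pf; have [B B0 gB] := poly_ulim_bounded qg.
have D0 : 0 < A + 1 + B by rewrite ltr_wpDr // ltr_wpDl.
have := divr_gt0 e0 D0; set d := _ / _ => d0.
have [N1 _ h1] := pf _ d0; have [N2 _ h2] := qg _ d0.
have [N3 _ h3] := pf _ ltr01.
exists (maxn N1 (maxn N2 N3)) => // n.
rewrite /= !geq_max => /and3P[/h1 {}h1 /h2 {}h2 /h3 {}h3] t tM.
rewrite hornerM.
have -> : (p n).[t] * (q n).[t] - f t * g t =
  (p n).[t] * ((q n).[t] - g t) + ((p n).[t] - f t) * g t by ring.
have -> : e = (A + 1) * d + d * B by rewrite /d; field; lra.
apply: le_trans (ler_normD _ _) _; rewrite !normrM.
rewrite lerD // ler_pM // ?h2 ?h1 ?gB //.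
rewrite -[(p n).[t]](subrK (f t)); apply: le_trans (ler_normD _ _) _.
by rewrite addrC lerD ?fA ?h3.
Qed.

Lemma poly_ulim_exp M p f k : poly_ulim M p f ->
  poly_ulim M (fun n => p n ^+ k) (fun t => f t ^+ k).
Proof.
move=> pf; elim: k => [|k IHk].
  by apply: poly_ulim_ext (poly_ulim_cst M 1) => t _; rewrite hornerC.
have := poly_ulim_mul pf IHk; rewrite (_ : (fun n => p n * _) = fun n => p n ^+ k.+1).
  by apply: poly_ulim_ext => t _; rewrite exprS.
by apply/funext => n; rewrite exprS.
Qed.

(** For exponents at most 1, [u <= u^r] on [[0, 1]]; apply it to the shares
    [s / (s + t)] and [t / (s + t)], which add up to 1. *)
Lemma powR_subadd (s t r : R) : 0 <= s -> 0 <= t -> 0 < r <= 1 ->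
  (s + t) `^ r <= s `^ r + t `^ r.
Proof.
move=> s0 t0 /andP[r0 r1].
have [st0|st0] := eqVneq (s + t) 0.
  by rewrite st0 powR0 ?gt_eqF // addr_ge0 // powR_ge0.
have st : 0 < s + t by rewrite lt0r st0 addr_ge0.
have key u : 0 <= u <= 1 -> u <= u `^ r.
  move=> /andP[u0 u1]; have [->|un0] := eqVneq u 0; first exact: powR_ge0.
  by rewrite -{1}(powRr1 u0) ger_powR // lt0r un0 u0.
have split u : 0 <= u <= s + t -> u / (s + t) * (s + t) `^ r <= u `^ r.
  move=> /andP[u0 ust].
  rewrite -{2}[u](divfK st0) powRM ?divr_ge0 ?(ltW st) //.
  rewrite ler_wpM2r ?powR_ge0 // key // divr_ge0 ?(ltW st) //=.
  by rewrite ler_pdivrMr // mul1r.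
have := lerD (split s _) (split t _).
rewrite -mulrDl -mulrDl divff // mul1r; apply; apply/andP; lra.
Qed.

Lemma powR_modulus (s t r : R) : 0 <= s -> 0 <= t -> 0 < r <= 1 ->
  `|s `^ r - t `^ r| <= `|s - t| `^ r.
Proof.
move=> s0 t0 r01; have [r0 _] := andP r01.
wlog ts : s t s0 t0 / t <= s => [hw|].
  have [|/ltW st] := leP t s; first exact: hw.
  by rewrite distrC [`|s - t|]distrC; exact: hw.
have st : 0 <= s - t by rewrite subr_ge0.
have := powR_subadd t0 st r01; rewrite addrC subrK => h.
rewrite (ger0_norm st) ger0_norm; first by rewrite lerBlDl.
by rewrite subr_ge0 ge0_ler_powR ?nnegrE // ltW.
Qed.

Lemma powR_poly_ulim01 (r : R) : 0 < r <= 1 ->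
  exists p, poly_ulim 1 p (fun t => t `^ r).
Proof.
move=> r01; have [r0 r1] := andP r01; eexists; apply: (@bernstein_ulim _ 1).
  move=> e e0; exists (e `^ r^-1) => [|s t /andP[s0 _] /andP[t0 _] st].
    exact: powR_gt0.
  apply: le_trans (powR_modulus s0 t0 r01) _.
  rewrite -[leRHS]powRr1 ?(ltW e0) // -(mulVf (lt0r_neq0 r0)) powRrM.
  by rewrite ge0_ler_powR ?nnegrE ?powR_ge0 // ltW.
move=> s /andP[s0 s1]; rewrite ger0_norm ?powR_ge0 //.
by have := @ge0_ler_powR R r (ltW r0) s 1; rewrite !nnegrE powR1; exact.
Qed.

(** Exponents at most 1 are rescaled from [[0, 1]]; a larger [r] is [k] times
    such an exponent, and products of uniform limits are uniform limits. *)
Lemma powR_poly_ulim M (r : R) : 0 <= r ->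
  exists p, poly_ulim M p (fun t => t `^ r).
Proof.
wlog M0 : M / 0 < M => [hw r0|].
  have [p hp] := hw (`|M| + 1) (ltr_wpDl (normr_ge0 _) ltr01) r0.
  exists p; apply: poly_ulim_le hp; apply: le_trans (ler_norm _) _.
  by rewrite lerDl.
have small s : 0 <= s <= 1 -> exists p, poly_ulim M p (fun t => t `^ s).
  move=> /andP[s0 s1]; have [->|sn0] := eqVneq s 0.
    exists (fun _ => 1); apply: poly_ulim_ext (poly_ulim_cst M 1) => t _.
    by rewrite hornerC powRr0.
  have [|p hp] := @powR_poly_ulim01 s; first by rewrite lt0r sn0 s0.
  exists (fun n => (M `^ s)%:P * (p n \Po ('X * (M^-1)%:P))) => e e0.
  have Ms : 0 < M `^ s by rewrite powR_gt0.
  have [N _ h] := hp _ (divr_gt0 e0 Ms); exists N => // n /h pn t /andP[t0 tM].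
  rewrite !(hornerE, horner_comp).
  have -> : t `^ s = M `^ s * (t / M) `^ s.
    by rewrite -powRM ?divr_ge0 ?(ltW M0) // mulrCA divff ?gt_eqF // mulr1.
  rewrite -mulrBr normrM gtr0_norm // mulrC -ler_pdivlMr //; apply: pn.
  by rewrite divr_ge0 ?(ltW M0) //= ler_pdivrMr // mul1r.
move=> r0; pose k := (Num.bound r).+1.
have k0 : 0 < k%:R :> R by rewrite ltr0n.
have [|p hp] := small (r / k%:R).
  rewrite divr_ge0 ?(ltW k0) //= ler_pdivrMr // mul1r.
  apply: ltW; apply: lt_le_trans (archi_boundP r0) _; by rewrite ler_nat.
exists (fun n => p n ^+ k).
apply: poly_ulim_ext (poly_ulim_exp k hp) => t /andP[t0 _].
by rewrite -powR_mulrn ?powR_ge0 // -powRrM divfK // gt_eqF.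
Qed.

(** As [u^s] vanishes at [0], the constant terms of approximating polynomials tend
    to [0] and may be dropped.  The quotients [k n] then approximate [u^(s - 1)] in
    the only sense possible near [0], after multiplication by [u]. *)
Lemma powR_factor M s : 0 < s ->
  exists k : nat -> {poly R}, poly_ulim M (fun n => k n * 'X) (fun t => t `^ s).
Proof.
move=> s0; have M0 : 0 <= Num.max M 0 by rewrite le_max lexx orbT.
have [q qs] := powR_poly_ulim (Num.max M 0) (ltW s0).
have /choice[k kq] : forall n, exists k, q n - (q n).[0]%:P = k * 'X.
  move=> n; have /factor_theorem[k ->] : root (q n - (q n).[0]%:P) 0.
    by rewrite /root !hornerE subrr.
  by exists k; rewrite subr0.
exists k; apply: (@poly_ulim_le M (Num.max M 0)).
  by rewrite le_max lexx.
move=> e e0; have e2 : 0 < e / 2 by rewrite divr_gt0.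
have [N _ h] := qs _ e2; exists N => // n /h qn t tM.
rewrite -kq hornerD hornerN hornerC.
have := qn 0; rewrite lexx M0 powR0 ?gt_eqF // subr0 => /(_ isT) q0.
rewrite addrAC; apply: le_trans (ler_normB _ _) _.
by rewrite [e]splitr lerD ?qn.
Qed.

End PolynomialApproximation.

(** * Functional calculus and real powers *)

Section Calculus.
Variables (R : realType) (H : hilbertType R).
Implicit Types (x y z : H) (a e M t : R) (S T P Q : 'B(H)) (f g : R -> R).

(** Translates the topology of uniform convergence into explicit bounds. *)
Lemma uniform_poly_ulim M (p : nat -> {poly R}) f :
  {uniform `[0, M]%classic, (fun n t => (p n).[t]) @ \oo --> f} <->
  poly_ulim M p f.
Proof.
split=> [pf e e0|pf U].
  have : nbhs (f : {uniform` `[0, M]%classic -> R})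
      [set h | forall t, `[0, M]%classic t -> `|f t - h t| < e].
    apply/uniform_nbhs; exists [set xy | ball xy.1 e xy.2].
    by split; first exact: entourage_ball (PosNum e0).
  move=> /pf[N _ h]; exists N => // n /h pn t tM.
  by rewrite distrC ltW // pn //= in_itv.
move=> /uniform_nbhs[E []]; rewrite -entourage_ballE => -[e /= e0 eE] EU.
have e2 : 0 < e / 2 by rewrite divr_gt0.
have [N _ h] := pf _ e2; exists N => // n /h pn; apply: EU => t /=.
rewrite in_itv /= => /pn pt; apply: eE; rewrite /= /ball /= distrC.
by apply: le_lt_trans pt _; rewrite ltr_pdivrMr // ltr_pMr // ltr1n.
Qed.

(** [is_calculus] with an arbitrary interval [[0, M]] in place of
    [[0, opnorm S]], so that two operators can share one approximating
    sequence. *)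
Definition calculus M S f P := exists p, poly_ulim M p f /\
  oplim (fun n => poly_op (p n) S) P.

Lemma is_calculusP S f P : is_calculus f S P <-> calculus (opnorm S) S f P.
Proof.
by split=> -[p [/uniform_poly_ulim pf /oplimP pP]]; exists p.
Qed.

Lemma poly_ulim_poly_op M S p q f : 0 <= M -> pos_bounded M S ->
  poly_ulim M p f -> poly_ulim M q f ->
  forall e, 0 < e -> exists N, forall n m, (N <= n)%N -> (N <= m)%N ->
    forall x, rnorm (poly_op (p n) S x - poly_op (q m) S x) <= e * rnorm x.
Proof.
move=> M0 SM pf qf e e0; have e2 : 0 < e / 2 by rewrite divr_gt0.
have [N1 _ h1] := pf _ e2; have [N2 _ h2] := qf _ e2.
exists (maxn N1 N2) => n m; rewrite !geq_max => /andP[/h1 pn _] /andP[_ /h2 qm] x.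
change (rnorm ((poly_op (p n) S - poly_op (q m) S) x) <= e * rnorm x).
rewrite -poly_opN -poly_opD.
apply: (poly_op_contraction M0 SM (ltW e0)) => t tM.
rewrite hornerD hornerN -(subrKA (f t)); apply: le_trans (ler_normD _ _) _.
by rewrite [e]splitr lerD ?pn // distrC qm.
Qed.

Lemma calculus_lim M S f P q : 0 <= M -> pos_bounded M S ->
  calculus M S f P -> poly_ulim M q f -> oplim (fun n => poly_op (q n) S) P.
Proof.
move=> M0 SM [p [pf pP]] qf; apply: (oplim_sub pP) => e e0.
have [N h] := poly_ulim_poly_op M0 SM qf pf e0.
by exists N => // n Nn x; rewrite subr0; exact: h.
Qed.

Lemma calculus_unique M S f P Q : 0 <= M -> pos_bounded M S ->
  calculus M S f P -> calculus M S f Q -> P = Q.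
Proof.
move=> M0 SM fP [q [qf qQ]]; apply: oplim_unique qQ.
exact: calculus_lim fP qf.
Qed.

Lemma calculus_exists M S f p : 0 <= M -> pos_bounded M S -> poly_ulim M p f ->
  exists P, calculus M S f P.
Proof.
move=> M0 SM pf.
have [|P pP] := @oplim_complete _ _ (fun n => poly_op (p n) S).
  exact: (poly_ulim_poly_op M0 SM pf pf).
by exists P, p.
Qed.

Lemma calculus_ext M S f g P : (forall t, 0 <= t <= M -> f t = g t) ->
  calculus M S f P -> calculus M S g P.
Proof. by move=> fg [p [pf pP]]; exists p; split=> //; exact: poly_ulim_ext pf. Qed.

Lemma calculus_le M M' S f P : M <= M' -> calculus M' S f P -> calculus M S f P.
Proof. by move=> MM [p [pf pP]]; exists p; split=> //; exact: poly_ulim_le pf. Qed.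

Lemma calculus_poly M S (p : {poly R}) : calculus M S (horner p) (poly_op p S).
Proof. exists (fun _ => p); split; [exact: poly_ulim_cst|exact: oplim_cst]. Qed.

Lemma calculus_mul M S f g P Q : calculus M S f P -> calculus M S g Q ->
  calculus M S (fun t => f t * g t) (P * Q).
Proof.
move=> [p [pf pP]] [q [qg qQ]]; exists (fun n => p n * q n).
split; first exact: poly_ulim_mul.
rewrite (_ : (fun n => _) = fun n => poly_op (p n) S * poly_op (q n) S).
  exact: oplim_mul.
by apply/funext => n; rewrite poly_opM.
Qed.

Lemma oplim_rinner (T_ : nat -> 'B(H)) T x y : oplim T_ T ->
  (fun n => rinner (T_ n x) y) @ \oo --> rinner (T x) y.
Proof.
move=> TT; apply/cvgrPdist_le => e e0.
pose D := rnorm x * rnorm y + 1.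
have D0 : 0 < D by rewrite ltr_wpDl // mulr_ge0 // rnorm_ge0.
have [N _ h] := TT _ (divr_gt0 e0 D0); exists N => // n /h /(_ x) hn.
rewrite /= -[rinner (T x) y]opprK -rinnerNl -opprD -rinnerDl normrN addrC.
apply: le_trans (rinner_cauchy_schwarz _ _) _.
apply: le_trans (ler_wpM2r (rnorm_ge0 _) hn) _.
by rewrite -mulrA mulrAC ler_pdivrMr // ler_wpM2l ?(ltW e0) // lerDl.
Qed.

Lemma calculus_selfadjoint M S f P : selfadjoint S -> calculus M S f P ->
  selfadjoint P.
Proof.
move=> Ss [p [_ pP]] x y; rewrite [RHS]rinnerC.
have h : (fun n => rinner (poly_op (p n) S x) y) @ \oo --> rinner (P y) x.
  rewrite (_ : (fun n => _) = fun n => rinner (poly_op (p n) S y) x).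
    exact: oplim_rinner.
  by apply/funext => n; rewrite (selfadjoint_poly_op _ Ss) rinnerC.
by rewrite -(cvg_lim _ h) // -(cvg_lim _ (oplim_rinner pP)).
Qed.

(** The same polynomials serve for [S] and [T], so [intertwine_poly] passes to the
    limit. *)
Lemma calculus_intertwine A S T M f P Q : 0 <= M -> pos_bounded M S ->
    pos_bounded M T -> A * S = T * A ->
  calculus M S f P -> calculus M T f Q -> A * P = Q * A.
Proof.
move=> M0 SM TM AST [p [pf pP]] fQ.
have pQ := calculus_lim M0 TM fQ pf.
apply: oplim_unique (oplim_mul (oplim_cst A) pP) _.
rewrite (_ : (fun n => _) = fun n => poly_op (p n) T * A).
  by apply: (oplim_mul pQ); exact: oplim_cst.
by apply/funext => n; exact: intertwine_poly.
Qed.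

(** Justifies the choice made in [powop]: approximate on the larger interval
    [[0, M]], restrict to [[0, opnorm S]], and use uniqueness there. *)
Lemma powop_calculus M S r : positive_op S -> opnorm S <= M -> 0 <= r ->
  calculus M S (fun t => t `^ r) (powop S r).
Proof.
move=> S0 SM r0; have M0 := le_trans (opnorm_ge0 S) SM.
have [p pr] := powR_poly_ulim M r0.
have [P rP] := calculus_exists M0 (positive_op_bounded S0 SM) pr.
have rP' := calculus_le SM rP.
suff <- : P = powop S r by [].
rewrite /powop; case: xgetP => [Q _ /= /is_calculusP rQ|/(_ P)[]]; last first.
  exact/is_calculusP.
apply: calculus_unique rP' rQ; first exact: opnorm_ge0.
exact: positive_op_bounded.
Qed.

Lemma powop_unique M S r P : positive_op S -> opnorm S <= M -> 0 <= r ->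
  calculus M S (fun t => t `^ r) P -> powop S r = P.
Proof.
move=> S0 SM r0; apply: calculus_unique (powop_calculus S0 SM r0).
  exact: le_trans (opnorm_ge0 S) SM.
exact: positive_op_bounded.
Qed.

(** Exponents [r = s = 0] have to be treated apart because of [0^0 = 1]. *)
Lemma powR_add_ge0 t r s : 0 <= r -> 0 <= s -> t `^ (r + s) = t `^ r * t `^ s.
Proof.
move=> r0 s0; have [rs|rs] := eqVneq (r + s) 0; last by rewrite powRD // (negPf rs).
move/eqP: rs; rewrite paddr_eq0 // => /andP[/eqP -> /eqP ->].
by rewrite addr0 powRr0 mulr1.
Qed.

Lemma powop_add S r s : positive_op S -> 0 <= r -> 0 <= s ->
  powop S (r + s) = powop S r * powop S s.
Proof.
move=> S0 r0 s0; apply: (powop_unique S0 (lexx _)); first exact: addr_ge0.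
apply: calculus_ext (calculus_mul (powop_calculus S0 (lexx _) r0)
  (powop_calculus S0 (lexx _) s0)) => t _.
by rewrite powR_add_ge0.
Qed.

Lemma powop1 S : positive_op S -> powop S 1 = S.
Proof.
move=> S0; apply: (powop_unique S0 (lexx _) ler01).
rewrite -[X in calculus _ _ _ X](poly_opX S).
by apply: calculus_ext (calculus_poly _ _ _) => t /andP[t0 _]; rewrite hornerX powRr1.
Qed.

Lemma powop0 S : positive_op S -> powop S 0 = 1.
Proof.
move=> S0; apply: (powop_unique S0 (lexx _) (lexx _)).
rewrite -[X in calculus _ _ _ X](poly_op1 S).
by apply: calculus_ext (calculus_poly _ _ _) => t _; rewrite hornerC powRr0.
Qed.

Lemma powop_selfadjoint S r : positive_op S -> 0 <= r -> selfadjoint (powop S r).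
Proof.
move=> S0 r0; have [Ss _] := S0.
exact: calculus_selfadjoint Ss (powop_calculus S0 (lexx _) r0).
Qed.

Lemma powop_double S r x : positive_op S -> 0 <= r ->
  rinner (powop S (r + r) x) x = rnorm (powop S r x) ^+ 2.
Proof.
by move=> S0 r0; rewrite powop_add // powop_selfadjoint // rinner_rnorm.
Qed.

(** [S^r] is the square of the self-adjoint operator [S^(r/2)]. *)
Lemma powop_positive S r : positive_op S -> 0 <= r -> positive_op (powop S r).
Proof.
move=> S0 r0; split=> [|x]; first exact: powop_selfadjoint.
by rewrite [r]splitr powop_double ?divr_ge0 // sqr_ge0.
Qed.

End Calculus.

(** * The mixed Schwarz inequality *)

Section MixedSchwarz.
Variables (R : realType) (H : hilbertType R).
Implicit Types (x y z : H) (A B C S T P Q : 'B(H)) (r s t : R).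

Lemma gram_positive A : positive_op (adjoint A * A).
Proof.
split=> [x y|x]; rewrite !bop_mulE.
  by rewrite rinnerC -!rinner_adjoint rinnerC.
by rewrite rinnerC -rinner_adjoint rinner_rnorm sqr_ge0.
Qed.

Lemma absop_positive A : positive_op (absop A).
Proof. by apply: powop_positive; [exact: gram_positive|rewrite invr_ge0]. Qed.

Lemma absop_sqr A : absop A * absop A = adjoint A * A.
Proof.
have A0 := gram_positive A.
by rewrite /absop -powop_add ?invr_ge0 // -div1r -splitr powop1.
Qed.

Lemma rnorm_absop A x : rnorm (absop A x) = rnorm (A x).
Proof.
apply/eqP; rewrite -(eqrXn2 (n:=2)) ?rnorm_ge0 //; apply/eqP.
have [As _] := absop_positive A.
by rewrite -!rinner_rnorm (rinner_adjoint A) As -bop_mulE absop_sqr.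
Qed.

(** [A S = T A], where [S = A* A] and [T = A A*], passes to the square roots of
    [S] and [T].  This replaces the partial isometry of the polar
    decomposition. *)
Lemma absop_intertwine A : A * absop A = absop (adjoint A) * A.
Proof.
pose S := adjoint A * A; pose T := adjoint (adjoint A) * adjoint A.
pose M := Num.max (opnorm S) (opnorm T).
have SM : opnorm S <= M by rewrite le_max lexx.
have TM : opnorm T <= M by rewrite le_max lexx orbT.
have half : 0 <= 2^-1 :> R by rewrite invr_ge0.
apply: (@calculus_intertwine _ _ A S T M (fun t => t `^ 2^-1)).
- exact: le_trans (opnorm_ge0 _) SM.
- exact: (positive_op_bounded (gram_positive A) SM).
- exact: (positive_op_bounded (gram_positive (adjoint A)) TM).
- by rewrite /T adjointK mulrA.
- exact: (powop_calculus (gram_positive A) SM half).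
- exact: (powop_calculus (gram_positive (adjoint A)) TM half).
Qed.

(** Let [s = 1 - t] and let [k_n(u) u] tend to [u^s] uniformly.  Then
    [A k_n(B) B^t] tends to [A], since [|A v| = |B v|] and [B k_n(B) B^t] tends
    to [B^s B^t = B].  On the other side,
    [<A k_n(B) B^t x, y> = <B^t x, A* k_n(C) y>], and
    [|A* k_n(C) y| = |C k_n(C) y|] tends to [|C^s y|]. *)
Lemma rinner_mixed_schwarz A B C t x y :
    positive_op B -> positive_op C ->
    (forall u, rnorm (B u) = rnorm (A u)) ->
    (forall u, rnorm (C u) = rnorm (adjoint A u)) -> A * B = C * A ->
    0 <= t <= 1 ->
  rinner (A x) y <= rnorm (powop B t x) * rnorm (powop C (1 - t) y).
Proof.
move=> B0 C0 BA CA AB /andP[t0 t1].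
have [->|tn1] := eqVneq t 1.
  (* [u^0 = 1] does not vanish at 0, so there is no [k_n]; but [C^0 = 1]. *)
  rewrite (powop1 B0) subrr (powop0 C0) BA.
  by apply: le_trans (ler_norm _) _; exact: rinner_cauchy_schwarz.
have s0 : 0 < 1 - t by rewrite subr_gt0 lt_neqAle tn1.
set s := 1 - t in s0 *; set G := powop B t; set K := powop C s.
have BG : powop B s * G = B by rewrite -powop_add ?(ltW s0) // subrK powop1.
pose M := Num.max (opnorm B) (opnorm C).
have BM : opnorm B <= M by rewrite le_max lexx.
have CM : opnorm C <= M by rewrite le_max lexx orbT.
have M0 : 0 <= M := le_trans (opnorm_ge0 B) BM.
have [k ks] := powR_factor M s0.
have kB := calculus_lim M0 (positive_op_bounded B0 BM)
  (powop_calculus B0 BM (ltW s0)) ks.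
have kC := calculus_lim M0 (positive_op_bounded C0 CM)
  (powop_calculus C0 CM (ltW s0)) ks.
apply/ler_addgt0Pr => e e0.
(* The error made by [k_ n] is at most [2 d |G x| |y|], which must stay below
   [e]; the [+ 1] makes [D] positive. *)
pose D := 2 * rnorm (G x) * rnorm y + 1.
have D0 : 0 < D by rewrite ltr_wpDl // !mulr_ge0 // rnorm_ge0.
have := divr_gt0 e0 D0; set d := e / D => d0.
have [N1 _ h1] := kB _ d0; have [N2 _ h2] := kC _ d0.
pose n := maxn N1 N2; pose k_ := k n.
have {h1} hB : rnorm (A x - A (poly_op k_ B (G x))) <= d * rnorm (G x).
  have := h1 n (leq_maxl _ _) (G x).
  rewrite rnormB_sym -bop_mulE BG mulrC poly_opM poly_opX bop_mulE.
  by rewrite -!linearB BA.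
have {h2} hC : rnorm (adjoint A (poly_op k_ C y)) <= rnorm (K y) + d * rnorm y.
  have := h2 n (leq_maxr _ _) y.
  rewrite mulrC poly_opM poly_opX bop_mulE => hK.
  rewrite -CA -[C _](subrK (K y)) addrC.
  by apply: le_trans (rnormD _ _) _; rewrite lerD2l.
have inter : A (poly_op k_ B (G x)) = poly_op k_ C (A (G x)).
  have /(congr1 (fun T : 'B(H) => T (G x))) :=
    intertwine_poly k_ AB.
  by [].
have [Cs _] := C0.
have -> : rinner (A x) y = rinner (A x - A (poly_op k_ B (G x))) y +
    rinner (G x) (adjoint A (poly_op k_ C y)).
  by rewrite -rinner_adjoint -(selfadjoint_poly_op _ Cs) -inter -rinnerDl subrK.
have -> : e = d * (2 * rnorm (G x) * rnorm y) + d.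
  by rewrite -[X in _ + X]mulr1 -mulrDr divfK // gt_eqF.
have a1 := le_trans (ler_norm _) (rinner_cauchy_schwarz
  (A x - A (poly_op k_ B (G x))) y).
have a2 := le_trans (ler_norm _) (rinner_cauchy_schwarz
  (G x) (adjoint A (poly_op k_ C y))).
have b1 := ler_wpM2r (rnorm_ge0 y) hB.
have b2 := ler_wpM2l (rnorm_ge0 (G x)) hC.
lra.
Qed.

(** Kato's inequality.  Both sides are absolutely homogeneous in [x], so the bound
    on real parts is a bound on moduli. *)
Theorem mixed_schwarz A t x y : 0 <= t <= 1 ->
  rnorm '[A x, y] <= rnorm (powop (absop A) t x) *
                     rnorm (powop (absop (adjoint A)) (1 - t) y).
Proof.
move=> t01; apply: rnorm_inner_le => c.
have bopZ (T : 'B(H)) : c *: T x = T (c *: x) by rewrite linearZ.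
rewrite bopZ mulrA -rnormZ bopZ; apply: rinner_mixed_schwarz t01.
- exact: absop_positive.
- exact: absop_positive.
- exact: rnorm_absop.
- exact: rnorm_absop.
- exact: absop_intertwine.
Qed.

(** Cauchy-Schwarz for [<P^(2r) x, x> = |P^r x|^2] gives at most [|P^(2r) x|],
    whose square is [<P^(4r) x, x>]. *)
Lemma powop_norm_le P r x : positive_op P -> 0 <= r -> rnorm x = 1 ->
  rnorm (powop P r x) ^+ 4 <= rinner (powop P (4 * r) x) x.
Proof.
move=> P0 r0 x1; have rr : 0 <= r + r by rewrite addr_ge0.
have -> : 4 * r = (r + r) + (r + r) by ring.
rewrite powop_double // (exprM _ 2 2) lerXn2r ?nnegrE ?sqr_ge0 ?rnorm_ge0 //.
rewrite -powop_double //; apply: le_trans (ler_norm _) _.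
by apply: le_trans (rinner_cauchy_schwarz _ _) _; rewrite x1 mulr1.
Qed.

Lemma sqr_inner_le A t x : 0 <= t <= 1 -> rnorm x = 1 ->
  rnorm '[A x, x] ^+ 2 <= 2^-1 *
    rinner ((powop (absop (adjoint A)) (4 * (1 - t))
             + powop (absop A) (4 * t)) x) x.
Proof.
move=> t01 x1; have [t0 t1] := andP t01; have s0 : 0 <= 1 - t by rewrite subr_ge0.
have amgm (a b c u v : R) : 0 <= a -> a <= b * c -> b ^+ 4 <= u -> c ^+ 4 <= v ->
    a ^+ 2 <= 2^-1 * (v + u).
  move=> a0 abc bu cv.
  have : a ^+ 2 <= (b * c) ^+ 2 by rewrite lerXn2r // nnegrE // (le_trans a0).
  have := sqr_ge0 (b ^+ 2 - c ^+ 2); lra.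
rewrite rinnerDl; apply: amgm (rnorm_ge0 _) (mixed_schwarz A x x t01) _ _.
  exact: powop_norm_le (absop_positive A) t0 x1.
exact: powop_norm_le (absop_positive (adjoint A)) s0 x1.
Qed.

(** In the zero space there are no unit vectors and the radius is the supremum of
    the empty set, which is 0. *)
Lemma euclidean_radius_le (d : nat) (A : 'I_d -> 'B(H)) (P : 'B(H)) :
  (forall x, rnorm x = 1 ->
     \sum_(k < d) rnorm '[A k x, x] ^+ 2 <= 2^-1 * rinner (P x) x) ->
  euclidean_radius A <= Num.sqrt (2^-1 * opnorm P).
Proof.
move=> h; rewrite /euclidean_radius; set E := [set _ | _ in _].
have [->|/set0P E0] := eqVneq E set0; first by rewrite sup0 sqrtr_ge0.
apply: ge_sup => // _ [x /= x1 <-]; apply: ler_wsqrtr.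
apply: le_trans (h x x1) _; rewrite ler_wpM2l ?invr_ge0 //.
apply: le_trans (ler_norm _) _; apply: le_trans (rinner_cauchy_schwarz _ _) _.
by rewrite x1 mulr1; have := rnorm_bop_le P x; rewrite x1 mulr1.
Qed.

End MixedSchwarz.

Theorem corollary2p7 (R : realType) (H : hilbertType R) (d : nat)
    (d_ge1 : (1 <= d)%N) (A : 'I_d -> 'B(H)) :
  (forall t : R, 0 <= t <= 1 ->
    euclidean_radius A <=
      Num.sqrt (2^-1 * opnorm (\sum_(k < d)
        (powop (absop (adjoint (A k))) (4 * (1 - t))
         + powop (absop (A k)) (4 * t))))) /\
  euclidean_radius A <=
    Num.sqrt (2^-1 * opnorm (\sum_(k < d)
      (absop (adjoint (A k)) ^+ 2 + absop (A k) ^+ 2))).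
Proof.
have main (t : R) : 0 <= t <= 1 -> euclidean_radius A <=
    Num.sqrt (2^-1 * opnorm (\sum_(k < d)
      (powop (absop (adjoint (A k))) (4 * (1 - t))
       + powop (absop (A k)) (4 * t)))).
  move=> t01; apply: euclidean_radius_le => x x1.
  rewrite bop_sumE /rinner linear_sumlz raddf_sum mulr_sumr.
  by apply: ler_sum => k _; exact: sqr_inner_le.
split=> //.
have half : 0 <= (2^-1 : R) <= 1 by rewrite invr_ge0 ler0n invf_le1 ?ler1n.
have sqr_powop (P : 'B(H)) : positive_op P -> powop P (1 + 1) = P ^+ 2.
  by move=> P0; rewrite powop_add // powop1.
have := main _ half.
have -> : 4 * (1 - 2^-1) = 1 + 1 :> R by field.
have -> : 4 * 2^-1 = 1 + 1 :> R by field.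
rewrite (eq_bigr (fun k => absop (adjoint (A k)) ^+ 2 + absop (A k) ^+ 2)) //.
move=> k _; congr (_ + _); apply: sqr_powop; exact: absop_positive.
Qed.
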